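(* Let $\mathfrak B$ be a Boolean algebra. Then $\mathfrak B$ carries a strictly positive nonatomic finitely additive probability measure if and only if there is a decomposition $\mathfrak B\setminus\{0\}=\bigcup_{n<\omega}\mathfrak B_n$ such that for each $n<\omega$: (i) $\mathfrak B_n\subseteq\mathfrak B_{n+1}$; (ii) $\mathrm{int}(\mathfrak B_n)\ge 2^{-n}$; (iii) for every $a\in\mathfrak B_n$ there are disjoint $b,c\in\mathfrak B_{n+1}$ with $b\vee c\le a$.
   Context: A (finitely additive) measure on a Boolean algebra $\mathfrak B$ is a function $\mu:\mathfrak B\to[0,\infty)$ with $\mu(a\vee b)=\mu(a)+\mu(b)$ whenever $a\wedge b=0$; it is a probability if $\mu(1)=1$, and strictly positive if $\mu(a)>0$ for all $a\ne 0$. A measure $\mu$ is nonatomic if for every $\varepsilon>0$ there is a finite partition of $1_{\mathfrak B}$ into pairwise disjoint elements each of measure $<\varepsilon$. Elements $b,c$ are disjoint if $b\wedge c=0$. For a family $\mathcal F\subseteq\mathfrak B\setminus\{0\}$, the intersection number $\mathrm{int}(\mathcal F)$ is the supremum of all $\alpha\ge0$ such that for every finite sequence $a_1,\dots,a_m$ of elements of $\mathcal F$ (repetitions allowed) there is a set $I\subseteq\{1,\dots,m\}$ with $|I|\ge\alpha m$ and $\bigwedge_{i\in I}a_i\ne 0$. *)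

(* Defs.v *)
From HB Require Import structures.
From mathcomp Require Import all_boot all_order all_algebra.
From mathcomp Require Import all_classical all_reals all_analysis.
Set Implicit Arguments. Unset Strict Implicit. Unset Printing Implicit Defensive.
Import Order.TTheory GRing.Theory Num.Theory.
Local Open Scope classical_set_scope.
Local Open Scope ring_scope.

Section BA.
Variables (d : Order.disp_t) (B : ctbDistrLatticeType d) (R : realType).

Definition fa_measure (mu : B -> R) : Prop :=
  (forall a, 0 <= mu a) /\
  (forall a b, (a `&` b = \bot)%O -> mu (a `|` b)%O = mu a + mu b).

Definition fa_probability (mu : B -> R) : Prop :=
  fa_measure mu /\ mu \top%O = 1.

Definition strictly_positive (mu : B -> R) : Prop :=
  forall a : B, a != \bot%O -> 0 < mu a.

Definition nonatomic (mu : B -> R) : Prop :=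
  forall eps : R, 0 < eps ->
    exists (k : nat) (p : 'I_k -> B),
      (forall i j, i != j -> (p i `&` p j = \bot)%O) /\
      (\join_(i < k) p i)%O = \top%O /\
      (forall i, mu (p i) < eps).

Definition int_witness (F : set B) (alpha : R) : Prop :=
  forall (m : nat) (a : 'I_m -> B), (forall i, F (a i)) ->
    exists I : {set 'I_m},
      alpha * m%:R <= (#|I|)%:R /\ (\meet_(i in I) a i)%O != \bot%O.

Definition intersection_number (F : set B) : \bar R :=
  ereal_sup [set (alpha%:E) | alpha in [set alpha | 0 <= alpha /\ int_witness F alpha]].

End BA.

(* Main.v *)
Require Import Defs.
From HB Require Import structures.
From mathcomp Require Import all_boot all_order all_algebra.
From mathcomp Require Import all_classical all_reals all_analysis.
From mathcomp Require Import ring lra.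
Import Order.TTheory GRing.Theory Num.Theory.
Import Order.Theory.
Local Open Scope classical_set_scope.
Local Open Scope ring_scope.

(* Left to right, take [B_n = {a | mu a > 2^-n}]: the strict inequality leaves room to cut off,
   by nonatomicity, a piece of [a] of measure only slightly above [2^-(n+1)].

   Right to left, let [alpha a = 2^-n] for the least [n] with [a] in [B_n]. Replacing each [a] in
   [B_n] by [2^k] disjoint elements of [B_(n+k)] below it reduces any finite family to a single
   [B_N], so (ii) and (iii) make [alpha] satisfy Kelley's condition
   [sum_(a <- l) alpha a <= c * max_x #{a in l | x a}] with [c = 1], where [x] ranges over the
   homomorphisms to [bool] (the points of the Stone space). A maximal function satisfying Kelley's
   condition is a finitely additive measure, so some measure [mu >= alpha] has mass at most [c].
   Choose [c] least possible. If [mu] were not nonatomic, some point [x] would satisfy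
   [mu a >= eps] whenever [x a], so [nu = mu - eps * delta_x] would be a measure. Of [2^k] disjoint
   elements of [B_(n+k)] below [a] at most one contains [x], whence [nu a >= 2^-n - 2^-(n+k)] for all
   [k]; thus [nu >= alpha], and its smaller mass contradicts the choice of [c]. *)

(** * Maximal sets for conditions of finite character *)

Lemma tukey (T : eqType) (Phi : seq T -> Prop) (A0 : set T) :
  (forall l : seq T, [set` l] `<=` A0 -> Phi l) ->
  exists A : set T, [/\ A0 `<=` A,
    forall l : seq T, [set` l] `<=` A -> Phi l &
    forall t, ~ A t -> exists2 l : seq T, [set` l] `<=` t |` A & ~ Phi l].
Proof.
move=> PhiA0.
(* A finite list from the union of a chain lies in one member; adjoining [A0] inside [P] settles the
   empty chain too. *)
pose P (A : set T) := forall l : seq T, [set` l] `<=` A0 `|` A -> Phi l.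
have [F FP Ftot|A [PA Amax]] := @Zorn_bigcup T P.
  move=> l lF.
  have : [set` l] `<=` A0 \/ exists2 X, F X & [set` l] `<=` A0 `|` X.
    elim: l lF => [_|t l IHl tlF]; first by left.
    have sub Y : Y t -> [set` l] `<=` Y -> [set` t :: l] `<=` Y.
      by move=> Yt lY u /=; rewrite inE => /predU1P[->|/lY].
    have {}IHl : [set` l] `<=` A0 \/ exists2 X, F X & [set` l] `<=` A0 `|` X.
      by apply: IHl => u ul; apply: tlF; rewrite /= inE (ul : u \in l) orbT.
    have [A0t|[Y FY Yt]] : (A0 `|` \bigcup_(X in F) X) t.
      by apply: tlF; rewrite /= mem_head.
      case: IHl => [lA0|[X FX lX]]; [left|right; exists X] => //; apply: sub => //.
      by left.
    right; case: IHl => [lA0|[X FX lX]].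
      by exists Y => //; apply: sub; [right|move=> u /lA0; left].
    have [XY|YX] := Ftot _ _ FX FY.
      exists Y => //; apply: sub; first by right.
      by move=> u /lX[|/XY]; [left|right].
    by exists X => //; apply: sub => //; right; apply: YX.
  by case=> [/PhiA0//|[X /FP PX /PX]].
exists (A0 `|` A); split=> // t At.
suff : ~ P (t |` A).
  by move=> /existsNP[l /not_implyP[lA nPhi]]; exists l => // u /lA; rewrite setUCA.
apply: Amax; split; first by move=> u; right.
by move=> /(_ t (or_introl erefl)) ?; apply: At; right.
Qed.

(** * Ultrafilters, as homomorphisms to [bool] *)

Section BooleanHomomorphisms.
Context {d : Order.disp_t} {B : ctbDistrLatticeType d}.
Implicit Types (a b e : B) (x : B -> bool) (l : seq B).

Definition bool_hom x : Prop :=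
  [/\ x \top%O, forall a b, x (a `&` b)%O = x a && x b
    & forall a, x (~` a)%O = ~~ x a].

Lemma bool_hom_join x : bool_hom x -> forall a b, x (a `|` b)%O = x a || x b.
Proof.
by move=> [_ xI xC] a b; rewrite -[LHS]negbK -xC complU xI !xC -negb_or negbK.
Qed.

Lemma bool_hom_bot x : bool_hom x -> x \bot%O = false.
Proof. by case=> x1 xI xC; rewrite -(meetxC \top%O) xI xC x1. Qed.

Lemma bool_hom_le x : bool_hom x -> forall a b, (a <= b)%O -> x a -> x b.
Proof. by move=> [_ xI _] a b /meet_idPl <-; rewrite xI => /andP[]. Qed.

(** The ultrafilter theorem: a maximal family with nonzero finite meets is an ultrafilter, and
    membership in it is a homomorphism. *)
Lemma centered_bool_hom (F : set B) :
  (forall l, [set` l] `<=` F -> (\meet_(a <- l) a)%O != \bot%O) ->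
  exists2 x, bool_hom x & forall a, F a -> x a.
Proof.
move=> /tukey[J [FJ Jcent Jmax]].
(* Maximality gives a list from [J] and [a] with zero meet; without the copies of [a], its meet lies
   below the complement of [a]. *)
have Jext a : ~ J a ->
    exists2 l, [set` l] `<=` J & (\meet_(b <- l) b <= ~` a)%O.
  move=> /Jmax[l lJ /negP]; rewrite negbK => /eqP l0.
  exists [seq b <- l | b != a] => [b /=|].
    by rewrite mem_filter => /andP[ba /lJ[]] // eba; rewrite eba eqxx in ba.
  rewrite -disj_leC -lex0 -l0; apply/meetsP_seq => b bl _.
  have [->|ba] := eqVneq b a; first exact: leIr.
  by apply: leIxl; apply: meets_inf_seq => //; rewrite mem_filter /= ba.
have Jup l a : [set` l] `<=` J -> (\meet_(b <- l) b <= a)%O -> J a.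
  move=> lJ la; apply: contrapT => /Jext[l' l'J l'a].
  suff /Jcent/negP[] : [set` l ++ l'] `<=` J.
    by rewrite -lex0 big_cat -(meetxC a) leI2.
  by move=> b /=; rewrite mem_cat => /orP[/lJ|/l'J].
have J1 : J \top%O by apply: (Jup [::]); rewrite ?big_nil.
have JI a b : J (a `&` b)%O <-> J a /\ J b.
  split=> [Jab|[Ja Jb]].
    by split; apply: (Jup [:: (a `&` b)%O]);
      rewrite ?big_seq1 ?leIl ?leIr// => c; rewrite /= inE => /eqP->.
  apply: (Jup [:: a; b]); last by rewrite big_cons big_seq1.
  by move=> c; rewrite /= !inE => /orP[]/eqP->.
have JC a : J (~` a)%O <-> ~ J a.
  split=> [JCa Ja|/Jext[l]]; last exact: Jup.
  suff /Jcent/negP[] : [set` [:: (a `&` ~` a)%O]] `<=` J.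
    by rewrite big_seq1 meetxC.
  by move=> c; rewrite /= inE => /eqP->; apply/JI.
exists (fun a => `[< J a >]) => [|a /FJ /asboolP //].
split=> [|a b|a]; first exact/asboolP.
  apply/asboolP/andP => [/JI[Ja Jb]|[/asboolP Ja /asboolP Jb]].
    by split; apply/asboolP.
  exact/JI.
by rewrite -asbool_neg; apply/asboolP/asboolP => /JC.
Qed.

Lemma bool_hom_exists e : e != \bot%O -> exists2 x, bool_hom x & x e.
Proof.
move=> e0; have [l le|x xhom xe] := centered_bool_hom [set e].
  apply: contraNneq e0 => l0; rewrite -lex0 -l0.
  by apply/meetsP_seq => b /le /= ->.
by exists x => //; apply: xe.
Qed.

End BooleanHomomorphisms.

(** * Finitely additive measures and Kelley's condition *)

Section FinitelyAdditiveMeasures.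
Context {R : realType} {d : Order.disp_t} {B : ctbDistrLatticeType d}.
Implicit Types (a b e y : B) (x : B -> bool) (l : seq B) (mu : B -> R).

Lemma fa_measure_bot mu : fa_measure mu -> mu \bot%O = 0.
Proof. by move=> [_ /(_ \bot \bot)%O]; rewrite meetxx joinxx => /(_ erefl); lra. Qed.

Lemma fa_measure_split mu a e :
  fa_measure mu -> mu e = mu (e `&` a)%O + mu (e `&` ~` a)%O.
Proof.
move=> [_ <-]; first by rewrite -meetUr joinxC meetx1.
by rewrite meetACA meetxC meetx0.
Qed.

Lemma fa_measure_le mu a b : fa_measure mu -> (a <= b)%O -> mu a <= mu b.
Proof.
move=> mu_fa ab; rewrite (fa_measure_split mu a b mu_fa) meetC.
by rewrite (meet_idPl ab) lerDl; case: mu_fa.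
Qed.

Lemma fa_measure_join_le mu a b :
  fa_measure mu -> mu (a `|` b)%O <= mu a + mu b.
Proof.
move=> mu_fa; rewrite (fa_measure_split mu a _ mu_fa) meetC joinKI lerD2l.
by apply: fa_measure_le => //; rewrite meetUl meetxC join0x leIl.
Qed.

Lemma bool_hom_fa_measure x : bool_hom x -> fa_measure (fun a => (x a)%:R : R).
Proof.
move=> xhom; split=> [a|a b ab0]; first exact: ler0n.
have := bool_hom_bot x xhom; rewrite -ab0 bool_hom_join//.
by case: xhom => _ -> _; case: (x a) (x b) => -[]//= _; rewrite ?addr0 ?add0r.
Qed.

(* Induction on [l], localised to [e] so that [e] can be split along the head of [l]. *)
Lemma sum_fa_measure_le_local mu l e (k : R) : fa_measure mu ->
  (forall x, bool_hom x -> x e -> \sum_(a <- l) (x a)%:R <= k) ->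
  \sum_(a <- l) mu (a `&` e)%O <= k * mu e.
Proof.
move=> mu_fa; elim: l e k => [|a l IHl] e k lk.
  rewrite big_nil; have [->|/bool_hom_exists[x xhom xe]] := eqVneq e \bot%O.
    by rewrite fa_measure_bot// mulr0.
  rewrite mulr_ge0//; first by have := lk x xhom xe; rewrite big_nil.
  by case: mu_fa.
have in_a : \sum_(b <- l) mu (b `&` (e `&` a))%O <= (k - 1) * mu (e `&` a)%O.
  apply: IHl => x xhom; case: (xhom) => _ -> _ /andP[xe xa].
  by have := lk x xhom xe; rewrite big_cons xa lerBrDl.
have in_aC : \sum_(b <- l) mu (b `&` (e `&` ~` a))%O <= k * mu (e `&` ~` a)%O.
  apply: IHl => x xhom; case: (xhom) => _ -> xC; rewrite xC => /andP[xe xa].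
  by have := lk x xhom xe; rewrite big_cons (negbTE xa) add0r.
rewrite big_cons (eq_bigr (fun b => mu (b `&` (e `&` a))%O
  + mu (b `&` (e `&` ~` a))%O)) => [|b _]; last first.
  by rewrite (fa_measure_split mu a (b `&` e)%O)// -!meetA.
by rewrite big_split/= (fa_measure_split mu a e mu_fa) [(a `&` e)%O]meetC; lra.
Qed.

Lemma sum_fa_measure_le mu l (k : R) : fa_measure mu ->
  (forall x, bool_hom x -> \sum_(a <- l) (x a)%:R <= k) ->
  \sum_(a <- l) mu a <= k * mu \top%O.
Proof.
move=> mu_fa lk; under eq_bigr do rewrite -[a in mu a]meetx1.
by apply: sum_fa_measure_le_local => // x xhom _; apply: lk.
Qed.

Lemma sum_flatten_nseq (T : Type) (l : seq T) n (F : T -> R) :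
  \sum_(p <- flatten (nseq n l)) F p = (\sum_(p <- l) F p) *+ n.
Proof. by rewrite big_flatten big_nseq iter_addr_0. Qed.

Lemma mem_flatten_nseq (T : eqType) (l : seq T) n p :
  p \in flatten (nseq n l) -> p \in l.
Proof. by move=> /flattenP[l']; rewrite mem_nseq => /andP[_ /eqP->]. Qed.

(* Tukey's lemma is applied to the hypograph [A] of the function to be maximised, and [mu] is the
   supremum of its fibres: every finite list of pairs in [A] has to satisfy Kelley's condition. *)
Lemma fa_measure_above (alpha : B -> R) (c : R) : 0 <= c ->
  (forall l, exists2 x, bool_hom x &
     \sum_(a <- l) alpha a <= c * \sum_(a <- l) (x a)%:R) ->
  exists mu, [/\ fa_measure mu, mu \top%O <= c & forall a, alpha a <= mu a].
Proof.
move=> c0 alphac.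
(* [g x w <= 0] says that the values in [w] sum to at most [c] times the number of listed elements
   containing [x]. *)
pose g x (w : seq (B * R)) := \sum_(p <- w) (p.2 - c * (x p.1)%:R).
have [w wA0|A [A0A Acons Amax]] :=
    @tukey _ (fun w => exists2 x, bool_hom x & g x w <= 0)
           [set p : B * R | p.2 = alpha p.1].
  have [x xhom wx] := alphac (map fst w); exists x => //.
  rewrite /g sumrB -mulr_sumr; move: wx; rewrite !big_map subr_le0.
  by apply: le_trans; rewrite le_eqVlt (eq_big_seq (fun p => alpha p.1)) ?eqxx.
(* By maximality, a pair outside [A] breaks the condition at every point once [n] copies of it join
   some list from [A]. *)
have ext y s : ~ A (y, s) -> exists (w : seq (B * R)) n, [set` w] `<=` A /\
    forall x, bool_hom x -> 0 < g x w + (s - c * (x y)%:R) *+ n.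
  move=> /Amax[w wA nPhi].
  exists [seq p <- w | p != (y, s)], (count_mem (y, s) w); split.
    move=> p /=; rewrite mem_filter => /andP[pys /wA[pE|//]].
    by rewrite pE eqxx in pys.
  move=> x xhom; rewrite ltNge; apply/negP => gle; apply: nPhi.
  exists x => //; rewrite /g (bigID (pred1 (y, s)))/= addrC.
  rewrite [X in _ + X](eq_bigr (fun=> s - c * (x y)%:R)) => [|p /eqP->//].
  by rewrite big_const_seq iter_addr_0 -big_filter.
have Ale y r : A (y, r) -> r <= c.
  move=> Ayr; have [] := Acons [:: (y, r)].
    by move=> p; rewrite /= inE => /eqP->.
  by move=> x xhom; rewrite /g big_seq1/=; case: (x y) => /=; lra.
pose S y := [set r | A (y, r)].
have S0 y : S y !=set0 by exists (alpha y); apply: A0A.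
have Ssup y : has_sup (S y) by split => //; exists c => r /Ale.
pose mu y := sup (S y).
have Smu y r : S y r -> r <= mu y by move=> Sr; apply: ub_le_sup => //; case: (Ssup y).
have {}ext y s : mu y < s -> exists (w : seq (B * R)) n, [set` w] `<=` A /\
    forall x, bool_hom x -> 0 < g x w + (s - c * (x y)%:R) *+ n.
  by move=> ys; apply: ext => /Smu; rewrite leNgt ys.
exists mu; split; last 2 first.
- by apply: ge_sup => // r /Ale.
- by move=> a; apply: Smu; apply: A0A.
split=> [y|a b ab0].
  rewrite leNgt; apply/negP => /ext[w [n [wA wpos]]].
  have [x xhom] := Acons w wA; rewrite leNgt => /negP; apply.
  apply: lt_le_trans (wpos x xhom) _; rewrite gerDl sub0r mulNrn oppr_le0.
  by rewrite mulrn_wge0 // mulr_ge0.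
have xab x : bool_hom x -> (x (a `|` b)%O)%:R = (x a)%:R + (x b)%:R :> R.
  by move=> /bool_hom_fa_measure[_ ->].
apply/eqP; rewrite eq_le; apply/andP; split.
  apply: ge_sup => // r Sr; rewrite leNgt; apply/negP => mur.
  (* Half the excess: [mu a + e] and [mu b + e] leave the hypograph, while their sum is exactly
     [r]. *)
  pose e := (r - mu a - mu b) / 2.
  have [w1 [n1 [w1A w1pos]]] : exists (w : seq (B * R)) n, [set` w] `<=` A /\
      forall x, bool_hom x -> 0 < g x w + (mu a + e - c * (x a)%:R) *+ n.
    by apply: ext; rewrite /e; lra.
  have [w2 [n2 [w2A w2pos]]] : exists (w : seq (B * R)) n, [set` w] `<=` A /\
      forall x, bool_hom x -> 0 < g x w + (mu b + e - c * (x b)%:R) *+ n.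
    by apply: ext; rewrite /e; lra.
  have n2_gt0 : (0 < n2)%N.
    rewrite lt0n; apply/eqP => n20; have [x xhom] := Acons w2 w2A.
    by have := w2pos x xhom; rewrite n20 mulr0n addr0 ltNge => /negP.
  (* Repeating the lists [n2] and [n1] times equalises the multiplicities, so [n1 * n2] copies of
     the pair at the join replace both outside pairs and [g] stays positive everywhere. *)
  have [] := Acons (flatten (nseq n2 w1) ++ flatten (nseq n1 w2)
    ++ nseq (n1 * n2) ((a `|` b)%O, r)).
    move=> p /=; rewrite !mem_cat mem_nseq => /or3P[].
    - by move=> /mem_flatten_nseq/w1A.
    - by move=> /mem_flatten_nseq/w2A.
    - by move=> /andP[_ /eqP->].
  move=> x xhom; rewrite /g !big_cat/= !sum_flatten_nseq big_nseq iter_addr_0/=.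
  rewrite xab// -/(g x w1) -/(g x w2); apply/negP; rewrite -ltNge.
  have /= h1 := w1pos x xhom; have /= h2 := w2pos x xhom.
  have -> : r = (mu a + e) + (mu b + e) by rewrite /e; field.
  rewrite [ltRHS](_ : _ =
      (g x w1 + (mu a + e - c * (x a)%:R) *+ n1) *+ n2
    + (g x w2 + (mu b + e - c * (x b)%:R) *+ n2) *+ n1); last by ring.
  by rewrite ltr_pwDl ?mulrn_wge0 ?pmulrn_rgt0 ?ltW.
rewrite -lerBrDr; apply: ge_sup => // ra Sa; rewrite lerBrDr addrC -lerBrDr.
apply: ge_sup => // rb Sb; rewrite lerBrDr addrC leNgt; apply/negP.
(* Conversely, the [n] copies of the pair at the join with value [ra + rb] are traded for [n] copies
   each of [(a, ra)] and [(b, rb)]. *)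
move=> /ext[w [n [wA wpos]]].
have [] := Acons (w ++ nseq n (a, ra) ++ nseq n (b, rb)).
  move=> p /=; rewrite !mem_cat !mem_nseq => /or3P[/wA//||];
  by move=> /andP[_ /eqP->].
move=> x xhom; rewrite /g !big_cat/= !big_nseq !iter_addr_0/= -/(g x w).
apply/negP; rewrite -ltNge addrA (_ : _ + _ = g x w +
    (ra + rb - c * (x (a `|` b)%O)%:R) *+ n); first exact: wpos.
by rewrite xab//; ring.
Qed.

End FinitelyAdditiveMeasures.

Lemma exists_exp2N_lt (R : realType) (e : R) : 0 < e -> exists k : nat, 2 ^- k < e.
Proof.
move=> e0; exists (Num.bound e^-1).
rewrite invf_plt ?posrE ?exprn_gt0//.
apply: lt_trans (archi_boundP _) _; first by rewrite invr_ge0 ltW.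
by rewrite -natrX ltr_nat ltn_expl.
Qed.

(** * Intersection numbers and consequences of nonatomicity *)

Section IntersectionNumbers.
Context {R : realType} {d : Order.disp_t} {B : ctbDistrLatticeType d}.
Hypothesis B_nontrivial : (\bot%O : B) != \top%O.
Implicit Types (a b e y : B) (x : B -> bool) (l : seq B) (mu : B -> R).

(** The sums are counts bounded by [size l], so a largest one is attained; nontriviality provides a
    first homomorphism. *)
Lemma max_bool_hom l : exists2 x, bool_hom x &
  forall x', bool_hom x' ->
    \sum_(a <- l) (x' a)%:R <= \sum_(a <- l) (x a)%:R :> R.
Proof.
have cnt x : \sum_(a <- l) (x a)%:R = (count x l)%:R :> R.
  by rewrite -natr_sum -sumn_count sumnE big_map.
pose P n := `[< exists2 x, bool_hom x & count x l = n >].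
have exP : exists n, P n.
  have [|x xhom _] := @bool_hom_exists _ B \top%O; first by rewrite eq_sym.
  by exists (count x l); apply/asboolP; exists x.
have ubP n : P n -> (n <= size l)%N by move=> /asboolP[x _ <-]; exact: count_size.
have [n /asboolP[x xhom xn] nmax] := ex_maxnP exP ubP.
exists x => // x' x'hom; rewrite !cnt ler_nat xn nmax//.
by apply/asboolP; exists x'.
Qed.

(** An ultrafilter through the nonzero meet contains every [a i] with [i] in [I]. A point of maximal
    count serves all admissible [alpha] at once, hence their supremum. *)
Lemma intersection_number_bool_hom (F : set B) (delta : R) l :
  (delta%:E <= intersection_number R F)%E -> [set` l] `<=` F ->
  exists2 x, bool_hom x & delta * (size l)%:R <= \sum_(a <- l) (x a)%:R.
Proof.
move=> deltaF lF; have [x xhom xmax] := max_bool_hom l; exists x => //.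
have [l0|l_gt0] := posnP (size l).
  by rewrite l0 mulr0 sumr_ge0.
rewrite -ler_pdivlMr ?ltr0n// -lee_fin; apply: le_trans deltaF _.
apply: ge_ereal_sup => _ [alpha [_ alphaF] <-]; rewrite lee_fin ler_pdivlMr ?ltr0n//.
have [|I [alphaI /bool_hom_exists[x' x'hom x'I]]] := alphaF _ (tnth (in_tuple l)).
  by move=> i; apply: lF => /=; rewrite mem_tnth.
apply: le_trans alphaI _; apply: le_trans _ (xmax x' x'hom).
rewrite big_tnth -sum1_card natr_sum [leRHS](bigID (mem I))/= ler_wpDr ?sumr_ge0//.
apply: ler_sum => i iI; rewrite (bool_hom_le x' x'hom _ _ _ x'I)//.
exact: meets_inf.
Qed.

(** The easy half of Kelley's theorem: the sum of [mu] over the list is at most the largest number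
    of terms sharing a point, and [I] indexes those terms. *)
Lemma fa_probability_int_witness mu (F : set B) (delta : R) :
  fa_probability mu -> (forall a, F a -> delta <= mu a) -> int_witness F delta.
Proof.
move=> [mu_fa mu1] Fdelta m a Fa; pose l := [seq a i | i <- enum 'I_m].
have [x xhom xmax] := max_bool_hom l.
exists [set i | x (a i)]%SET; split.
  have := sum_fa_measure_le mu l _ mu_fa xmax.
  rewrite mu1 mulr1 big_map [X in _ <= X -> _]big_map !big_enum /= => mu_x.
  apply: (@le_trans _ _ (\sum_(i < m) mu (a i))).
    rewrite mulr_natr -[m in _ *+ m]card_ord -sumr_const.
    by apply: ler_sum => i _; apply: Fdelta.
  apply: le_trans mu_x _; rewrite -sum1_card natr_sum [leRHS]big_mkcond/=.
  by apply: ler_sum => i _; rewrite inE; case: (x _).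
apply/eqP => meet0; have := bool_hom_bot x xhom; rewrite -meet0.
case: xhom => x1 xI _; elim/big_rec: _ => [|i b]; first by rewrite x1.
by rewrite inE xI => ->.
Qed.

Lemma disjoint_refinement l : exists s : seq B,
  [/\ pairwise (fun a b => a `&` b == \bot)%O s,
      (\join_(b <- s) b = \join_(a <- l) a)%O &
      forall b, b \in s -> exists2 a, a \in l & (b <= a)%O].
Proof.
elim: l => [|a l [s [sdisj sl sle]]]; first by exists [::].
exists (a :: [seq (b `&` ~` a)%O | b <- s]); split.
- rewrite /= pairwise_map all_map; apply/andP; split.
    by apply/allP => b _ /=; rewrite meetCA meetxC meetx0.
  apply: sub_pairwise sdisj => b c /eqP bc /=.
  by rewrite meetACA bc meet0x.
- rewrite !big_cons big_map.
  rewrite -(big_morph (Order.meet^~ (~` a)%O) (fun b c => meetUl b c _) (meet0x _)).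
  by rewrite sl joinIr joinxC meetx1.
- move=> b; rewrite inE => /predU1P[->|/mapP[c /sle[e el ce] ->]].
    by exists a; rewrite ?mem_head.
  by exists e; rewrite ?inE ?el ?orbT// leIxl.
Qed.

(** Elements covered by finitely many pieces of measure below [eps] form an ideal. If it contains
    [\top], the cover is made disjoint; otherwise some ultrafilter avoids it. *)
Lemma small_partition_or_bool_hom mu (eps : R) : fa_measure mu ->
  (exists (k : nat) (p : 'I_k -> B),
      (forall i j, i != j -> (p i `&` p j = \bot)%O) /\
      (\join_(i < k) p i)%O = \top%O /\ (forall i, mu (p i) < eps)) \/
  (exists2 x, bool_hom x & forall a, x a -> eps <= mu a).
Proof.
move=> mu_fa.
pose small e := exists2 l, (e <= \join_(a <- l) a)%O & forall a, a \in l -> mu a < eps.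
have [[l l1 leps]|Nsmall1] := pselect (small \top%O).
  left; have [s [sdisj sl sle]] := disjoint_refinement l.
  exists (size s), (fun i => nth \bot%O s i); split; last split.
  - have disj (i j : 'I_(size s)) : (i < j)%N ->
      (nth \bot s i `&` nth \bot s j = \bot)%O.
      by move=> ij; apply/eqP; apply: (pairwiseP _ sdisj) => //; exact: ltn_ord.
    move=> i j ij; have [/disj//|/disj|/val_inj ji] := ltngtP i j.
      by rewrite meetC.
    by rewrite ji eqxx in ij.
  - by apply/eqP; rewrite -le1x (le_trans l1)// -sl (big_nth \bot%O) big_mkord.
  - move=> i; have [|a al ia] := sle (nth \bot%O s i); first exact: mem_nth.
    by apply: le_lt_trans (leps a al); exact: fa_measure_le.
right.
have [l lsmall|x xhom xsmall] := centered_bool_hom [set a | small (~` a)%O].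
  apply: contra_notN Nsmall1 => /eqP l0; rewrite -(joinxC \bot%O) join0x -l0.
  elim: l lsmall {l0} => [_|a l IHl alsmall].
    rewrite big_nil; exists [::] => //; rewrite big_nil.
    by rewrite -(meetxC \top%O) meet1x.
  have [la ale aeps] : small (~` a)%O by apply: alsmall; rewrite /= mem_head.
  have [b bl|ll lle leps] := IHl.
    by apply: alsmall; rewrite /= inE (bl : b \in l) orbT.
  exists (la ++ ll); first by rewrite big_cons big_cat complI leU2.
  by move=> b; rewrite mem_cat => /orP[/aeps|/leps].
exists x => // a xa; rewrite leNgt; apply/negP => a_eps.
have : x (~` a)%O.
  apply: xsmall; exists [:: a]; rewrite ?big_seq1 ?complK// => b.
  by rewrite inE => /eqP->.
by case: xhom => _ _ ->; rewrite xa.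
Qed.

(** Joining pieces smaller than [eps] until the measure passes [t] overshoots by less than
    [eps = mu a - t *+ 2], so more than [t] of [a] remains. *)
Lemma nonatomic_split mu a (t : R) : fa_measure mu -> nonatomic mu ->
  0 <= t -> t *+ 2 < mu a ->
  exists b c, [/\ t < mu b, t < mu c, (b `&` c = \bot)%O & (b `|` c <= a)%O].
Proof.
move=> mu_fa mu_na t0 ta; pose eps := mu a - t *+ 2.
have [|k [p [_ [p1 peps]]]] := mu_na eps; first by rewrite subr_gt0.
have greedy l : (forall b, b \in l -> mu b < eps) -> t < mu (\join_(b <- l) b)%O ->
    exists u, [/\ (u <= \join_(b <- l) b)%O, t < mu u & mu u < t + eps].
  elim: l => [|b l IHl] leps; first by rewrite big_nil fa_measure_bot// ltNge t0.
  rewrite big_cons => tbl; have [tl|lt] := ltP t (mu (\join_(c <- l) c)%O).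
    have [c cl|u [ul tu ut]] := IHl _ tl; first by apply: leps; rewrite inE cl orbT.
    by exists u; split => //; apply: le_trans ul (leUr _ _).
  exists (b `|` \join_(c <- l) c)%O; split=> //.
  apply: le_lt_trans (fa_measure_join_le _ _ _ mu_fa) _.
  by rewrite addrC ler_ltD// leps// mem_head.
have pa : (\join_(b <- [seq a `&` p i | i <- enum 'I_k]) b = a)%O.
  by rewrite big_map big_enum/= -(big_morph (Order.meet a) (meetUr a) (meetx0 a)) p1 meetx1.
have [||u [ua tu ut]] := greedy [seq a `&` p i | i <- enum 'I_k]%O.
- move=> _ /mapP[i _ ->]; apply: le_lt_trans (peps i).
  by apply: fa_measure_le => //; exact: leIr.
- by rewrite pa; lra.
exists u, (a `&` ~` u)%O; split=> //.
- have := fa_measure_split mu u a mu_fa.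
  rewrite pa in ua; rewrite [(a `&` u)%O]meetC (meet_idPl ua) /eps in ut *.
  by lra.
- by rewrite meetCA meetxC meetx0.
- by rewrite leUx leIl andbT -[a in (_ <= a)%O]pa.
Qed.

End IntersectionNumbers.

(** * From a splitting decomposition to a nonatomic measure *)

Section SplittingFamilies.
Context {R : realType} {d : Order.disp_t} {B : ctbDistrLatticeType d}.
Hypothesis B_nontrivial : (\bot%O : B) != \top%O.
Variable Bn : nat -> set B.
Hypothesis Bn_int : forall n, ((2 ^- n)%:E <= intersection_number R (Bn n))%E.
Hypothesis Bn_split : forall n a, Bn n a -> exists b c,
  Bn n.+1 b /\ Bn n.+1 c /\ (b `&` c = \bot)%O /\ (b `|` c <= a)%O.
Implicit Types (a b e : B) (x : B -> bool) (l w : seq B) (mu : B -> R).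

(** The inequality for every [mu] records disjointness: for point masses, no point lies in more
    elements of [w'] than of [w]. *)
Lemma split_all w n : [set` w] `<=` Bn n -> exists w', [/\ [set` w'] `<=` Bn n.+1,
  size w' = (size w).*2 &
  forall mu, fa_measure mu -> \sum_(b <- w') mu b <= \sum_(a <- w) mu a].
Proof.
elim: w => [|a w IHw] awB; first by exists [::]; split=> // mu _; rewrite !big_nil.
have [|w' [w'B w'size w'w]] := IHw.
  by move=> b bw; apply: awB; rewrite /= inE (bw : b \in w) orbT.
have [|b [c [Bb [Bc [bc bca]]]]] := Bn_split n a; first by apply: awB; rewrite /= mem_head.
exists [:: b, c & w']; split=> [e|/=|mu mu_fa].
- by rewrite /= !inE => /or3P[/eqP->|/eqP->|/w'B].
- by rewrite w'size doubleS.
- rewrite !big_cons addrA lerD ?w'w//.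
  by case: (mu_fa) => _ <- //; exact: fa_measure_le.
Qed.

Lemma split_iter k w n : [set` w] `<=` Bn n -> exists w',
  [/\ [set` w'] `<=` Bn (n + k), size w' = (2 ^ k * size w)%N &
  forall mu, fa_measure mu -> \sum_(b <- w') mu b <= \sum_(a <- w) mu a].
Proof.
elim: k => [|k IHk] wB; first by exists w; rewrite addn0 expn0 mul1n.
have [w1 [w1B w1size w1w]] := IHk wB; have [w2 [w2B w2size w2w1]] := split_all _ _ w1B.
exists w2; rewrite addnS w2size w1size expnS -mulnA mul2n; split=> // mu mu_fa.
exact: le_trans (w2w1 mu mu_fa) (w1w mu mu_fa).
Qed.

Lemma level_weight : exists alpha : B -> R,
  (forall n a, Bn n a -> 2 ^- n <= alpha a) /\
  (forall a, alpha a = 0 \/ exists2 n, Bn n a & alpha a = 2 ^- n).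
Proof.
suff /choice[alpha alphaP] : forall a, exists r : R,
    (forall n, Bn n a -> 2 ^- n <= r) /\ (r = 0 \/ exists2 n, Bn n a & r = 2 ^- n).
  by exists alpha; split=> [n a|a]; have [] := alphaP a; first by move=> + _; apply.
move=> a; have [exn|nex] := pselect (exists n, `[< Bn n a >]); last first.
  by exists 0; split=> [n Bna|]; [case: nex; exists n; apply/asboolP|left].
have [n /asboolP Bna nmin] := ex_minnP exn.
exists (2 ^- n); split=> [m Bma|]; last by right; exists n.
rewrite lef_pV2 ?posrE ?exprn_gt0// ler_eXn2l ?ltr1n// nmin//.
exact/asboolP.
Qed.

(** Splitting brings all terms to a common level: each split doubles the number of elements and
    halves their weight, so the total is unchanged. *)
Lemma sum_weight_le (alpha : B -> R) :
  (forall a, alpha a = 0 \/ exists2 n, Bn n a & alpha a = 2 ^- n) ->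
  forall l, exists N w, [/\ [set` w] `<=` Bn N,
    \sum_(a <- l) alpha a = 2 ^- N * (size w)%:R &
    forall mu, fa_measure mu -> \sum_(b <- w) mu b <= \sum_(a <- l) mu a].
Proof.
move=> alphaP; elim=> [|a l [N [w [wB wsize wl]]]].
  by exists 0, [::]; rewrite big_nil mulr0; split=> // mu _; rewrite !big_nil.
have [a0|[n Bna an]] := alphaP a.
  exists N, w; rewrite big_cons a0 add0r; split=> // mu mu_fa.
  by rewrite big_cons ler_wpDl ?wl//; case: mu_fa.
(* The tail rises by [n] levels from [N], the head by [N] levels from [n]; both reach [N + n]. *)
have [w1 [w1B w1size w1w]] := split_iter n _ _ wB.
have [|w2 [w2B w2size w2a]] := @split_iter N [:: a] n.
  by move=> b; rewrite /= inE => /eqP->.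
exists (N + n)%N, (w1 ++ w2); split.
- by move=> b /=; rewrite mem_cat => /orP[/w1B|/w2B]//; rewrite addnC.
- rewrite big_cons wsize an size_cat w1size w2size muln1 natrD natrM !natrX exprD.
  field; rewrite !expf_neq0//=.
- move=> mu mu_fa; rewrite big_cat big_cons [leRHS]addrC lerD//.
    exact: le_trans (w1w mu mu_fa) (wl mu mu_fa).
  by have := w2a mu mu_fa; rewrite big_seq1.
Qed.

(** Kelley's condition, with the constant as a parameter to be minimised. *)
Definition dominates (alpha : B -> R) (c : R) : Prop :=
  forall l, exists2 x, bool_hom x &
    \sum_(a <- l) alpha a <= c * \sum_(a <- l) (x a)%:R.

Lemma weight_dominated (alpha : B -> R) :
  (forall a, alpha a = 0 \/ exists2 n, Bn n a & alpha a = 2 ^- n) ->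
  dominates alpha 1.
Proof.
move=> /sum_weight_le alphaw l; have [N [w [wB wsize wl]]] := alphaw l.
have [x xhom xw] := intersection_number_bool_hom B_nontrivial _ _ _ (Bn_int N) wB.
exists x => //; rewrite mul1r wsize (le_trans xw)//.
exact: wl (bool_hom_fa_measure x xhom).
Qed.

(** The infimum is attained: for each [l] a point of maximal count serves every admissible [c], and
    the resulting inequality is closed in [c]. *)
Lemma least_dominating (alpha : B -> R) : dominates alpha 1 ->
  exists c, [/\ 0 <= c, dominates alpha c &
    forall c', 0 <= c' -> dominates alpha c' -> c <= c'].
Proof.
move=> alpha1; pose S := [set c | 0 <= c /\ dominates alpha c].
have S0 : S !=set0 by exists 1; split.
have infS c : S c -> inf S <= c by apply: ge_inf; exists 0 => r [].
exists (inf S); split=> [|l|c' c'0 alphac']; last exact: infS.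
  by apply: lb_le_inf => // r [].
have [x xhom xmax] := @max_bool_hom R _ _ B_nontrivial l; exists x => //.
have xS c : S c -> \sum_(a <- l) alpha a <= c * \sum_(a <- l) (x a)%:R.
  by move=> [c0 /(_ l)[x' x'hom] /le_trans]; apply; rewrite ler_wpM2l ?xmax.
have : 0 <= \sum_(a <- l) (x a)%:R :> R by rewrite sumr_ge0.
rewrite le_eqVlt => /predU1P[x0|x_gt0].
  by have [c /xS] := S0; rewrite -x0 !mulr0.
rewrite -ler_pdivrMr//; apply: lb_le_inf => // c /xS.
by rewrite ler_pdivrMr.
Qed.

Lemma split_measure : exists mu : B -> R, [/\ fa_measure mu,
  (forall n a, Bn n a -> 2 ^- n <= mu a) & nonatomic mu].
Proof.
have [alpha [Bn_alpha alphaP]] := level_weight.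
have [c [c0 alphac cmin]] := least_dominating _ (weight_dominated _ alphaP).
have [mu [mu_fa muc alpha_mu]] := fa_measure_above alpha c c0 alphac.
have Bn_mu n a : Bn n a -> 2 ^- n <= mu a by move=> /Bn_alpha/le_trans; apply.
exists mu; split=> // eps eps0.
have [//|[x xhom x_eps]] := small_partition_or_bool_hom mu eps mu_fa.
exfalso; pose nu a := mu a - eps * (x a)%:R.
have x_fa := @bool_hom_fa_measure R _ _ x xhom.
have nu_fa : fa_measure nu.
  split=> [a|a b ab0]; rewrite /nu.
    by case: (boolP (x a)) => [/x_eps|_] /=; [lra|rewrite mulr0 subr0; case: mu_fa].
  by case: mu_fa => _ ->//; case: x_fa => _ ->//; ring.
have Bn_nu n a : Bn n a -> 2 ^- n <= nu a.
  move=> Bna; rewrite leNgt; apply/negP; rewrite -subr_gt0 => /exists_exp2N_lt[k].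
  have [|w [wB wsize wa]] := @split_iter k [:: a] n.
    by move=> b; rewrite /= inE => /eqP->.
  rewrite muln1 in wsize.
  have := wa _ nu_fa; have := wa _ x_fa; rewrite !big_seq1 => wx wnu.
  have xa1 : (x a)%:R <= 1 :> R by rewrite lern1; case: (x a).
  (* A piece missing [x] keeps its full measure under [nu], a piece containing [x] counts at least
     [0], and by [wx] and [xa1] at most one piece contains [x]. *)
  have : \sum_(b <- w) 2 ^- (n + k) * (1 - (x b)%:R) <= nu a :> R.
    apply: le_trans wnu; rewrite !big_seq; apply: ler_sum => b bw.
    rewrite /nu; case: (boolP (x b)) => xb /=.
      by rewrite subrr mulr0; have [/(_ b)] := nu_fa; rewrite /nu xb.
    by rewrite mulr0 !subr0 mulr1 Bn_mu//; apply: wB.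
  rewrite -mulr_sumr sumrB big_const_seq iter_addr_0 count_predT wsize.
  rewrite natrX exprD invfM => nuw /=.
  have pn1 : (2 : R) ^- n <= 1 by rewrite invf_le1 ?exprn_gt0// exprn_ege1// ler1n.
  have q_gt0 : 0 < (2 : R) ^- k by rewrite invr_gt0 exprn_gt0.
  have : 2 ^- n * (2 ^- k * 2 ^+ k) = 2 ^- n :> R.
    by rewrite mulVf ?mulr1// expf_neq0.
  have : 2 ^- n * 2 ^- k * \sum_(b <- w) (x b)%:R <= 2 ^- k :> R.
    rewrite mulrAC ler_piMl ?(ltW q_gt0)// mulr_ile1 ?invr_ge0 ?exprn_ge0 ?sumr_ge0//.
    exact: le_trans wx xa1.
  by move: nuw; rewrite mulrBr; lra.
have alpha_nu a : alpha a <= nu a.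
  by have [->|[n /Bn_nu Bna ->//]] := alphaP a; case: nu_fa.
(* The mass of [nu] is itself an admissible constant for [alpha], yet it is at most [c - eps]. *)
have : c <= nu \top%O.
  apply: cmin => [|l]; first by case: nu_fa.
  have [y yhom ymax] := @max_bool_hom R _ _ B_nontrivial l; exists y => //.
  rewrite mulrC; apply: le_trans (sum_fa_measure_le nu l _ nu_fa ymax).
  exact: ler_sum.
by have [x1 _ _] := xhom; rewrite /nu x1 mulr1 => ?; lra.
Qed.

End SplittingFamilies.

(** * Both implications, with normalisation of the total mass *)

Theorem theorem4p1 (R : realType) (d : Order.disp_t) (B : ctbDistrLatticeType d) :
  (\bot%O : B) != \top%O ->
  (exists mu : B -> R,
      fa_probability mu /\ strictly_positive mu /\ nonatomic mu)
  <->
  (exists Bn : nat -> set B,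
      (forall x : B, x != \bot%O <-> exists n, Bn n x) /\
      (forall n,
         Bn n `<=` Bn n.+1 /\
         (((2%:R : R) ^- n)%:E <= intersection_number R (Bn n))%E /\
         (forall a, Bn n a ->
            exists b c, Bn n.+1 b /\ Bn n.+1 c /\
              (b `&` c = \bot)%O /\ (b `|` c <= a)%O))).
Proof.
move=> B_nontrivial; split=> [[mu [mu_prob [mu_pos mu_na]]]|[Bn [BnU BnP]]].
  have [mu_fa mu1] := mu_prob.
  have expS n : (2 : R) ^- n = 2 ^- n.+1 *+ 2.
    by rewrite exprS; field; rewrite expf_neq0.
  have exp_ge0 n : 0 <= (2 : R) ^- n by rewrite invr_ge0 exprn_ge0.
  exists (fun n => [set a | 2 ^- n < mu a]); split=> [a|n]; last split; last split.
  - split=> [/mu_pos/exists_exp2N_lt//|[n na]]; apply: contraTneq na => ->.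
    by rewrite fa_measure_bot// -leNgt.
  - by move=> a /=; apply: le_lt_trans; rewrite [leRHS]expS mulr2n lerDl.
  - apply: ereal_sup_ubound; exists (2 ^- n) => //; split=> //.
    by apply: (fa_probability_int_witness B_nontrivial mu _ _ mu_prob) => a /ltW.
  (* For [t = 2 ^- n.+1], membership of [a] at level [n] reads [t *+ 2 < mu a], exactly the room
     needed to cut [a] in two. *)
  - move=> a /=; rewrite expS => /(nonatomic_split mu a _ mu_fa mu_na (exp_ge0 _)).
    by move=> [b [c [? ? ? ?]]]; exists b, c.
have [n|n a|mu [mu_fa Bn_mu mu_na]] := @split_measure R _ _ B_nontrivial Bn.
- by have [_ []] := BnP n.
- by have [_ [_ /(_ a)]] := BnP n.
have mu_pos : strictly_positive mu.
  by move=> a /BnU[n /Bn_mu]; apply: lt_le_trans; rewrite invr_gt0 exprn_gt0.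
have mu1_gt0 : 0 < mu \top%O by apply: mu_pos; rewrite eq_sym.
(* Only positivity of the total mass is known here; after dividing by it, partitions are taken for
   [eps * mu \top]. *)
exists (fun a => mu a / mu \top%O); split; [split|split].
- split=> [a|a b ab0]; first by rewrite divr_ge0 ?(ltW mu1_gt0)//; case: mu_fa.
  by case: mu_fa => _ ->//; rewrite mulrDl.
- by rewrite divff ?gt_eqF.
- by move=> a /mu_pos ?; rewrite divr_gt0.
- move=> eps eps0; have [|k [p [pdisj [p1 peps]]]] := mu_na (eps * mu \top%O).
    by rewrite mulr_gt0.
  by exists k, p; split=> //; split=> // i; rewrite ltr_pdivrMr.
Qed.
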